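(* Let $\mathbb U$ be the Fraïssé limit of a Fraïssé class in a countable first-order language, and let $\mathcal M$ be a sub-monoid of $\operatorname{Emb}(\mathbb U)$ which contains $\operatorname{Aut}(\mathbb U)$ and contains at least one non-surjective embedding. If $\mathcal M$ has the amalgamation property, then there exists a homogeneous structure $\mathbb U_{\omega_1}$ of cardinality $\aleph_1$ that is the union of a chain of structures isomorphic to $\mathbb U$.
   Context: A Fraïssé class is a class of finitely generated structures closed under isomorphism and substructures, with joint embedding, amalgamation and countably many isomorphism types; its Fraïssé limit $\mathbb U$ is the unique countably generated homogeneous structure (every isomorphism between finitely generated substructures extends to an automorphism) whose age is the class. $\operatorname{Emb}(\mathbb U)$ is the monoid of all self-embeddings of $\mathbb U$ under composition. A monoid $\mathcal M$ of self-embeddings has the amalgamation property if for all $f,g\in\mathcal M$ there exist $f',g'\in\mathcal M$ with $f'\circ f=g'\circ g$. *)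

(* Defs.v *)
From mathcomp Require Import all_boot.
From mathcomp Require Import boolp classical_sets functions cardinality wochoice.

Set Implicit Arguments.
Unset Strict Implicit.
Unset Printing Implicit Defensive.

Local Open Scope classical_set_scope.

(* Constants are function symbols of arity 0. *)
Record language := Language {
  fsym : Type;
  rsym : Type;
  farity : fsym -> nat;
  rarity : rsym -> nat }.

Definition countable_language (L : language) : Prop :=
  countable [set: fsym L] /\ countable [set: rsym L].

(* The carrier may be empty, if L has no constants. *)
Record structure (L : language) := Structure {
  carrier :> Type;
  finterp : forall s : fsym L, ('I_(farity s) -> carrier) -> carrier;
  rinterp : forall s : rsym L, ('I_(rarity s) -> carrier) -> Prop }.

Definition is_embedding (L : language) (A B : structure L) (f : A -> B) : Prop :=
  [/\ injective f,
      forall (s : fsym L) (a : 'I_(farity s) -> A),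
        f (finterp a) = finterp (f \o a)
    & forall (s : rsym L) (a : 'I_(rarity s) -> A),
        rinterp a <-> rinterp (f \o a)].

Definition is_isomorphism (L : language) (A B : structure L) (f : A -> B) : Prop :=
  is_embedding f /\ bijective f.

Definition isomorphic (L : language) (A B : structure L) : Prop :=
  exists f : A -> B, is_isomorphism f.

Definition Emb (L : language) (U : structure L) : set (U -> U) :=
  [set f | is_embedding f].

Definition Aut (L : language) (U : structure L) : set (U -> U) :=
  [set f | is_isomorphism f].

Definition fclosed (L : language) (A : structure L) (S : set A) : Prop :=
  forall (s : fsym L) (a : 'I_(farity s) -> A),
    (forall i, S (a i)) -> S (finterp a).

Record substructure (L : language) (A : structure L) := Substructure {
  universe :> set A;
  universe_closed : fclosed universe }.

Definition induced (L : language) (A : structure L) (S : substructure A) :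
    structure L :=
  @Structure L {x : A | universe S x}
    (fun s a => exist (universe S) (finterp (fun i => proj1_sig (a i)))
                  (universe_closed (fun i => proj2_sig (a i))))
    (fun s a => rinterp (fun i => proj1_sig (a i))).

Definition generates (L : language) (A : structure L) (X : set A) : Prop :=
  smallest (@fclosed L A) X = [set: A].

Definition finitely_generated (L : language) (A : structure L) : Prop :=
  exists X : set A, finite_set X /\ generates X.

Definition countably_generated (L : language) (A : structure L) : Prop :=
  exists X : set A, countable X /\ generates X.

Definition homogeneous (L : language) (A : structure L) : Prop :=
  forall S T : substructure A,
    finitely_generated (induced S) -> finitely_generated (induced T) ->
    forall f : induced S -> induced T, is_isomorphism f ->
    exists2 g : A -> A, Aut g & forall x : induced S,
      g (proj1_sig x) = proj1_sig (f x).

Definition age (L : language) (A : structure L) : set (structure L) :=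
  [set B | finitely_generated B /\ exists f : B -> A, is_embedding f].

(* Since the members of K are finitely generated, the hereditary property only
   concerns finitely generated substructures. *)
Record fraisse_class (L : language) (K : set (structure L)) : Prop := {
  fraisse_fg : forall A, K A -> finitely_generated A;
  fraisse_iso : forall A B, K A -> isomorphic A B -> K B;
  fraisse_hereditary : forall A, K A -> forall S : substructure A,
    finitely_generated (induced S) -> K (induced S);
  fraisse_joint_embedding : forall A B, K A -> K B ->
    exists C, [/\ K C, exists f : A -> C, is_embedding f
                     & exists g : B -> C, is_embedding g];
  fraisse_amalgamation : forall A B C, K A -> K B -> K C ->
    forall (f : A -> B) (g : A -> C), is_embedding f -> is_embedding g ->
    exists D, K D /\ exists (f' : B -> D) (g' : C -> D),
      [/\ is_embedding f', is_embedding g' & f' \o f = g' \o g];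
  fraisse_countable : exists F : nat -> structure L,
    forall A, K A -> exists n, isomorphic A (F n) }.

Definition fraisse_limit (L : language) (K : set (structure L))
    (U : structure L) : Prop :=
  [/\ countably_generated U, homogeneous U & age U = K].

Record submonoid_Emb (L : language) (U : structure L) (M : set (U -> U)) :
    Prop := {
  submonoid_sub : M `<=` @Emb L U;
  submonoid_id : M id;
  submonoid_comp : forall f g, M f -> M g -> M (f \o g) }.

Definition amalgamation_property (L : language) (U : structure L)
    (M : set (U -> U)) : Prop :=
  forall f g, M f -> M g ->
    exists f' g', [/\ M f', M g' & f' \o f = g' \o g].

(* T carries a well-order of type omega_1, the least uncountable ordinal:
   T is uncountable and all initial segments are countable. *)
Definition cardinality_aleph1 (T : Type) : Prop :=
  exists R : rel T, [/\ well_order R, ~ countable [set: T]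
                      & forall x, countable [set y | R y x]].

Definition union_of_chain_of_copies (L : language) (V U : structure L) : Prop :=
  exists C : set (substructure V),
    [/\ total_on C (fun S T => S `<=` T),
        forall S, C S -> isomorphic (induced S) U
      & \bigcup_(S in C) S = [set: V]].

(* Main.v *)
(* The limit U is countable and homogeneous, so automorphisms are pointwise
   dense in Emb(U) and the colimit of any sequence of self-embeddings of U is
   again a copy of U.  Amalgamation in M, iterated along such a sequence with a
   back-and-forth bookkeeping, yields for countably many automorphisms g_k of U
   one non-surjective embedding e of U such that every e o g_k extends along e
   to an automorphism.  (Composites of infinitely many steps may leave M, but
   this is harmless: M contains Aut(U), so it can be transported to each new
   copy of U independently of the identification.)

   Copies of U are placed on countable subsets of a set T of cardinality
   aleph_1.  Each copy carries a chosen automorphism for every finite partial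
   isomorphism of it, and an extension of copies must extend the choices.  Every
   copy has a proper extension and every countable chain has an upper bound, so
   the union V of a maximal chain is uncountable, hence of cardinality aleph_1.
   A finite partial isomorphism of V lives in some copy of the chain, and the
   automorphisms chosen for it from there on are coherent: their union is an
   automorphism of V. *)
Require Import Defs.
From mathcomp Require Import all_boot.
From mathcomp Require Import boolp classical_sets functions cardinality wochoice.
(* Re-imported because fingraph's [fclosed] shadows the one of Defs. *)
Import Defs.

Set Implicit Arguments.
Unset Strict Implicit.
Unset Printing Implicit Defensive.

Local Open Scope classical_set_scope.

(** * Embeddings, generation and homogeneity *)

Lemma embedding_id (L : language) (A : structure L) : is_embedding (@id A).
Proof. by split. Qed.

Lemma embedding_comp (L : language) (A B C : structure L) (f : A -> B)
    (g : B -> C) :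
  is_embedding f -> is_embedding g -> is_embedding (g \o f).
Proof.
move=> [fI fF fR] [gI gF gR]; split.
- exact: inj_comp.
- by move=> s a; rewrite /= fF gF.
- by move=> s a; rewrite fR gR.
Qed.

Lemma embedding_factor (L : language) (A B C : structure L) (f : A -> B)
    (g : B -> C) :
  is_embedding g -> is_embedding (g \o f) -> is_embedding f.
Proof.
move=> [gI gF gR] [hI hF hR]; split.
- by move=> x y e; apply: hI; rewrite /= e.
- by move=> s a; apply: gI; rewrite gF -[LHS]/((g \o f) _) hF.
- by move=> s a; rewrite (gR s) hR.
Qed.

Lemma embedding_surj_iso (L : language) (A B : structure L) (f : A -> B) :
  is_embedding f -> (forall y, exists x, f x = y) -> is_isomorphism f.
Proof.
move=> fE /choice[g fK]; split=> //; exists g => // x.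
by case: fE => fI _ _; apply: fI; rewrite fK.
Qed.

Lemma isomorphism_inverse (L : language) (A B : structure L) (f : A -> B) :
  is_isomorphism f ->
  exists g : B -> A, [/\ is_isomorphism g, cancel f g & cancel g f].
Proof.
move=> [fE [g fK gK]]; exists g; split=> //; split; last by exists f.
apply: (embedding_factor fE); split.
- by move=> x y /=; rewrite !gK.
- move=> s a /=; rewrite gK; congr finterp; apply/funext => i /=.
  by rewrite gK.
- move=> s a; suff -> : (f \o g) \o a = a by [].
  by apply/funext => i /=; rewrite gK.
Qed.

Lemma isomorphism_comp (L : language) (A B C : structure L) (f : A -> B)
    (g : B -> C) :
  is_isomorphism f -> is_isomorphism g -> is_isomorphism (g \o f).
Proof.
by move=> [fE fB] [gE gB]; split; [apply: embedding_comp | apply: bij_comp].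
Qed.

Lemma isomorphism_id (L : language) (A : structure L) : is_isomorphism (@id A).
Proof. by split; [exact: embedding_id | exists id]. Qed.

Lemma generatesP (L : language) (A : structure L) (X : set A) :
  generates X <->
  forall Y : set A, fclosed Y -> X `<=` Y -> forall x, Y x.
Proof.
split=> [XG Y Yc XY x|H].
  have Gx : smallest (@fclosed L A) X x by rewrite XG.
  exact: (Gx Y (conj Yc XY)).
by apply/seteqP; split=> // x _ Y [Yc XY]; apply: H.
Qed.

Lemma fclosed_preimage (L : language) (A B : structure L) (f : A -> B)
    (Y : set B) :
  is_embedding f -> fclosed Y -> fclosed (f @^-1` Y).
Proof. by move=> [_ fF _] Yc s a aY; rewrite /preimage /= fF; apply: Yc. Qed.

Lemma fclosed_equalizer (L : language) (A B : structure L) (f g : A -> B) :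
  is_embedding f -> is_embedding g -> fclosed [set x | f x = g x].
Proof.
move=> [_ fF _] [_ gF _] s a aE; rewrite /= fF gF; congr finterp.
by apply/funext => i; exact: aE.
Qed.

Lemma finitely_generated_iso (L : language) (A B : structure L) (f : A -> B) :
  is_isomorphism f -> finitely_generated A -> finitely_generated B.
Proof.
move=> [fE [g fK gK]] [X [Xfin /generatesP Xgen]].
exists (f @` X); split; first exact: finite_image.
apply/generatesP => Y Yc XY y; rewrite -(gK y).
apply: (Xgen (f @^-1` Y)); first exact: fclosed_preimage.
by move=> x Xx; apply: XY; exists x.
Qed.

Lemma fclosed_range (L : language) (A B : structure L) (f : A -> B) :
  is_embedding f -> fclosed (range f).
Proof.
move=> [_ fF _] s a /(_ _)/cid2-/all_sig2[c _ cE].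
exists (finterp c) => //; rewrite fF; congr finterp.
exact/funext.
Qed.

Definition range_substructure (L : language) (A B : structure L) (f : A -> B)
  (fE : is_embedding f) : substructure B := Substructure (fclosed_range fE).

Definition corestriction (L : language) (A B : structure L) (f : A -> B)
    (fE : is_embedding f) (x : A) : induced (range_substructure fE) :=
  exist (range f) (f x) (ex_intro2 _ _ x I erefl).

Lemma induced_val_embedding (L : language) (A : structure L)
    (S : substructure A) :
  is_embedding (fun x : induced S => proj1_sig x).
Proof. by split=> // -[x Sx] [y Sy] /= e; exact: eq_exist. Qed.

Lemma corestriction_iso (L : language) (A B : structure L) (f : A -> B)
    (fE : is_embedding f) : is_isomorphism (corestriction fE).
Proof.
apply: embedding_surj_iso => [|[y fy]].
  by apply: (embedding_factor (@induced_val_embedding _ _ _)).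
by have [x _ fx] := fy; exists x; exact: eq_exist.
Qed.

(** Corestricting both embeddings to their ranges gives isomorphisms with substructures of [A], to
    which homogeneity applies. Later arguments can thus avoid subtypes. *)
Lemma homogeneous_emb (L : language) (A C : structure L) (p q : C -> A) :
  homogeneous A -> finitely_generated C ->
  is_embedding p -> is_embedding q ->
  exists2 g : A -> A, Aut g & forall x, g (p x) = q x.
Proof.
move=> hA Cfg pE qE.
have [r [rI pK rK]] := isomorphism_inverse (corestriction_iso pE).
have [|||g gA gE] := hA (range_substructure pE) (range_substructure qE) _ _
  (corestriction qE \o r).
- exact: finitely_generated_iso (corestriction_iso pE) Cfg.
- exact: finitely_generated_iso (corestriction_iso qE) Cfg.
- by apply: isomorphism_comp => //; exact: corestriction_iso.
by exists g => // x; rewrite -[p x]/(proj1_sig (corestriction pE x)) gE /= pK.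
Qed.

Lemma fclosed_smallest (L : language) (A : structure L) (E : set A) :
  fclosed (smallest (@fclosed L A) E).
Proof. by move=> s a aE Y [Yc EY]; apply: (Yc s a) => i; exact: (aE i Y). Qed.

Definition generated_substructure (L : language) (A : structure L)
  (E : set A) : substructure A := Substructure (fclosed_smallest (E := E)).

Lemma generated_finitely_generated (L : language) (A : structure L)
    (E : set A) : finite_set E ->
  finitely_generated (induced (generated_substructure E)).
Proof.
move=> Efin; set S := generated_substructure E.
exists [set x : induced S | E (proj1_sig x)]; split.
  apply: finite_preimage => // x y _ _ e.
  by case: (induced_val_embedding S) => vI _ _; exact: vI.
apply/generatesP => Y Yc EY [x Sx].
pose Z : set A := [set a | exists h : universe S a, Y (exist _ a h)].
have [] : Z x; last by move=> h; rewrite (Prop_irrelevance h Sx).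
apply: (Sx Z); split; last first.
  by move=> a Ea; exists (@sub_gen_smallest _ _ _ a Ea); exact: EY.
move=> s a aZ; have aS i : universe S (a i) by case: (aZ i).
exists (universe_closed aS).
have aY i : Y (exist _ (a i) (aS i)).
  by case: (aZ i) => h; rewrite (Prop_irrelevance h (aS i)).
exact: (Yc s (fun i => exist _ (a i) (aS i)) aY).
Qed.

(** The inclusion of the substructure generated by [E] and its composite with [f] are two embeddings
    of one finitely generated structure. *)
Lemma aut_dense (L : language) (A : structure L) (f : A -> A) (E : set A) :
  homogeneous A -> is_embedding f -> finite_set E ->
  exists2 g : A -> A, Aut g & forall x, E x -> g x = f x.
Proof.
move=> hA fE Efin; set S := generated_substructure E.
have vE := induced_val_embedding S.
have [g gA gE] := homogeneous_emb hA (generated_finitely_generated Efin) vE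
  (embedding_comp vE fE).
exists g => // x Ex.
exact: (gE (exist _ x (@sub_gen_smallest _ _ _ x Ex))).
Qed.

(** * Countable structures and their colimits *)

Lemma countable_enum (T : Type) (X : set T) : countable X ->
  exists u : nat -> option T, forall x, X x -> exists n, u n = Some x.
Proof.
move=> /countable_injP[f fI].
have /choice[u uP] : forall n, exists o : option T,
    forall x, X x -> f x = n -> o = Some x.
  move=> n; have [[x [Xx fx]]|H] := pselect (exists x, X x /\ f x = n).
    by exists (Some x) => y Xy fy; rewrite (fI x y) ?inE // fx fy.
  by exists None => x Xx fx; case: H; exists x.
by exists u => x Xx; exists (f x); exact: uP.
Qed.

(** Closed terms over a countable generating set, coded as trees so that countability comes from
    [pickle]: leaves number generators, nodes number function symbols. The point [a0] stands in for
    meaningless codes and missing arguments. *)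
Fixpoint term_value (L : language) (A : structure L) (a0 : A)
    (s : nat -> option (fsym L)) (v : nat -> option A) (t : GenTree.tree nat) :
    A :=
  match t with
  | GenTree.Leaf n => odflt a0 (v n)
  | GenTree.Node n ts =>
      if s n is Some c
      then finterp (fun i : 'I_(farity c) =>
             nth a0 (map (term_value a0 s v) ts) i)
      else a0
  end.

Lemma countably_generated_enum (L : language) (A : structure L) (a0 : A) :
  countable_language L -> countably_generated A ->
  exists u : nat -> A, forall x, exists n, u n = x.
Proof.
move=> [/countable_enum[s sP] _] [X [/countable_enum[v vP] /generatesP XG]].
exists (fun n => term_value a0 s v (odflt (GenTree.Leaf 0) (unpickle n))).
suff H x : exists t, term_value a0 s v t = x.
  by move=> x; have [t <-] := H x; exists (pickle t); rewrite pickleK.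
apply: (XG [set x | exists t, term_value a0 s v t = x]) => {x} [c a|x Xx].
  move=> /choice[t tE]; have [n sn] := sP c I.
  exists (GenTree.Node n [seq t i | i <- enum 'I_(farity c)]) => /=.
  rewrite sn; congr finterp; apply/funext => i.
  by rewrite -map_comp (nth_map i) ?size_enum_ord ?ltn_ord // nth_ord_enum /= tE.
by have [n vn] := vP x Xx; exists (GenTree.Leaf n); rewrite /= vn.
Qed.

Lemma directed_family_ub (I : Type) (le : I -> I -> Prop) (n : nat)
    (f : 'I_n -> I) :
  inhabited I -> (forall i j k, le i j -> le j k -> le i k) ->
  (forall i j, exists k, le i k /\ le j k) ->
  exists k, forall j, le (f j) k.
Proof.
move=> [i0] letr ledir; elim: n f => [|n IH] f; first by exists i0 => -[].
have [k kP] := IH (fun j => f (lift ord0 j)).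
have [m [km fm]] := ledir k (f ord0).
exists m => j; have [j' ->|->//] := unliftP ord0 j.
exact: letr (kP j') km.
Qed.

(* A directed family of spans of embeddings amounts to an increasing union of
   partial isomorphisms from A to B. *)
Lemma glue_isomorphism (L : language) (A B : structure L) (I : Type)
    (C : I -> structure L) (p : forall i, C i -> A) (q : forall i, C i -> B) :
  inhabited I ->
  (forall i, is_embedding (p i)) -> (forall i, is_embedding (q i)) ->
  (forall i j, exists k,
    (forall x, exists y, p k y = p i x /\ q k y = q i x) /\
    (forall x, exists y, p k y = p j x /\ q k y = q j x)) ->
  (forall u, exists i x, p i x = u) -> (forall v, exists i x, q i x = v) ->
  exists2 g : A -> B, is_isomorphism g & forall i x, g (p i x) = q i x.
Proof.
move=> I0 pE qE dir pS qS.
pose le i k := forall x, exists y, p k y = p i x /\ q k y = q i x.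
have letr i j k : le i j -> le j k -> le i k.
  move=> ij jk x; have [y [<- <-]] := ij x; have [z [<- <-]] := jk y.
  by exists z.
have ub n (f : 'I_n -> I) := directed_family_ub f I0 letr dir.
have /choice[g gP] u : exists v, exists i x, p i x = u /\ q i x = v.
  by have [i [x <-]] := pS u; exists (q i x), i, x.
have gE i x : g (p i x) = q i x.
  have [j [y [pj <-]]] := gP (p i x).
  have [k [ik jk]] := dir i j.
  have [x' [px <-]] := ik x; have [y' [py <-]] := jk y.
  have [pI _ _] := pE k.
  by congr q; apply: pI; rewrite py pj px.
exists g => //; apply: embedding_surj_iso; last first.
  by move=> v; have [i [x <-]] := qS v; exists (p i x); rewrite gE.
have common n (a : 'I_n -> A) : exists i (c : 'I_n -> C i),
    a = p i \o c /\ g \o a = q i \o c.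
  have /choice[w wE] j : exists w : {i & C i}, p (tag w) (tagged w) = a j.
    by have [k [x <-]] := pS (a j); exists (Tagged C x).
  have [i iP] := ub _ (fun j => tag (w j)).
  have /choice[d dE] j := iP j (tagged (w j)).
  exists i, d; split; apply/funext => j /=; have [dp _] := dE j.
    by rewrite dp wE.
  by rewrite -(wE j) -dp gE.
split.
- move=> u v.
  have [i [x <-]] := pS u; have [j [y <-]] := pS v.
  have [k [ik jk]] := dir i j.
  have [x' [<- _]] := ik x; have [y' [<- _]] := jk y.
  by rewrite !gE; have [qI _ _] := qE k => /qI ->.
- move=> s a; have [i [c [-> ->]]] := common _ a.
  have [_ pF _] := pE i; have [_ qF _] := qE i.
  by rewrite -pF gE qF.
- move=> s a; have [i [c [-> ->]]] := common _ a.
  have [_ _ pR] := pE i; have [_ _ qR] := qE i.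
  by rewrite -pR qR.
Qed.

(* This is [f n.-1 \o .. \o f m], and the identity when [n <= m]. *)
Fixpoint transition (T : Type) (f : nat -> T -> T) (m n : nat) : T -> T :=
  if n is n'.+1
  then if m <= n' then f n' \o transition f m n' else id
  else id.

Lemma transition_geq (T : Type) (f : nat -> T -> T) (m n : nat) :
  n <= m -> transition f m n = id.
Proof. by case: n => [//|n] /= nm; rewrite leqNgt nm. Qed.

Lemma transitionS (T : Type) (f : nat -> T -> T) (m n : nat) :
  m <= n -> transition f m n.+1 = f n \o transition f m n.
Proof. by move=> mn /=; rewrite mn. Qed.

Lemma transitionSl (T : Type) (f : nat -> T -> T) (m n : nat) (x : T) :
  m < n -> transition f m.+1 n (f m x) = transition f m n x.
Proof.
elim: n => // n IH; rewrite ltnS leq_eqVlt => /orP[/eqP->|mn].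
  by rewrite transition_geq // transitionS // /= transition_geq.
by rewrite transitionS // (transitionS _ (ltnW mn)) /= IH.
Qed.

Lemma transition_embedding (L : language) (A : structure L)
    (f : nat -> A -> A) (m n : nat) :
  (forall n, is_embedding (f n)) -> is_embedding (transition f m n).
Proof.
move=> fE; elim: n => [|n IH] /=; first exact: embedding_id.
by case: ifP => _; [exact: embedding_comp | exact: embedding_id].
Qed.

(* The map [i n] is the pointwise limit of [al k \o f k.-1 \o .. \o f n] for
   automorphisms [al k] such that [al k.+1 \o f k] and [al k] agree on a finite
   set growing with k; they exist by density of [Aut A]. *)
Lemma chain_colimit (L : language) (A : structure L) (u : nat -> A)
    (f : nat -> A -> A) :
  homogeneous A -> (forall x, exists n, u n = x) ->
  (forall n, is_embedding (f n)) ->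
  exists i : nat -> A -> A, [/\ forall n, is_embedding (i n),
    forall n x, i n.+1 (f n x) = i n x & forall y, exists n x, i n x = y].
Proof.
move=> hA uS fE.
(* The first part follows [u 0], ..., [u k] from every stage up to [k], which makes the limits
   exist; the second protects the preimages of these points under [a], which makes the limits
   jointly surjective. *)
pose E k (a : A -> A) : set A :=
  (fun p => transition f p.1 k (u p.2)) @` (`I_k.+1 `*` `I_k.+1)
  `|` a @^-1` (u @` `I_k.+1).
have /choice[next nextP] (ka : nat * (A -> A)) : exists b : A -> A, Aut ka.2 ->
    Aut b /\ forall x, E ka.1 ka.2 x -> b (f ka.1 x) = ka.2 x.
  case: ka => k a /=; have [aA|aN] := pselect (Aut a); last by exists id.
  have Efin : finite_set (E k a).
    rewrite finite_setU; split; first exact/finite_image/finite_setX.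
    apply: finite_preimage; last exact: finite_image.
    by move=> x y _ _; case: aA => -[aI _ _] _; exact: aI.
  have [g gA gE] := aut_dense hA (fE k) Efin.
  have [h [hI gK hK]] := isomorphism_inverse gA.
  (* As [g] agrees with [f k] on [E k a], composing [a] with the inverse of [g] undoes [f k]
     there. *)
  exists (a \o h) => _; split; first exact: isomorphism_comp.
  by move=> x Ex; rewrite -gE //= gK.
have [al al0 al_next] : exists2 al, al 0 = id & forall n, al n.+1 = next (n, al n).
  by exists (fix al n := if n is n'.+1 then next (n', al n') else id).
have alA n : Aut (al n).
  elim: n => [|n IH]; first by rewrite al0; exact: isomorphism_id.
  by rewrite al_next; apply: (nextP (n, _) _).1.
have alS n x : E n (al n) x -> al n.+1 (f n x) = al n x.
  by rewrite al_next; exact: (nextP (n, al n) (alA n)).2.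
have alE n : is_embedding (al n) by case: (alA n).
have stable n x : exists N, forall k, N <= k -> n <= k /\
    al k (transition f n k x) = al N (transition f n N x).
  have [j <-] := uS x; exists (maxn n j) => k; rewrite geq_max.
  elim: k => [|k IH].
    by move=> /andP[]; rewrite !leqn0 => /eqP-> /eqP->.
  move=> /andP[nk jk]; split=> //.
  case: (leqP (maxn n j) k) => [|kl]; last first.
    by congr (al _ (transition f n _ (u j))); apply/eqP;
      rewrite eqn_leq kl geq_max nk.
  rewrite geq_max => /[dup] /IH[nk' <-] /andP[_ jk'].
  rewrite transitionS //= alS //; left.
  by exists (n, j); rewrite //= !ltnS.
have /choice[lim limP] (nx : nat * A) : exists v, exists N, forall k, N <= k ->
    nx.1 <= k /\ al k (transition f nx.1 k nx.2) = v.
  by case: nx => n x; have [N NP] := stable n x; exists (al N (transition f n N x)), N.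
pose i n x := lim (n, x).
have iP n x : exists N, forall k, N <= k ->
    n <= k /\ al k (transition f n k x) = i n x := limP (n, x).
have aE n k : is_embedding (al k \o transition f n k).
  by apply: embedding_comp => //; exact: transition_embedding.
have common m n (a : 'I_m -> A) : exists N, forall k, N <= k ->
    i n \o a = al k \o transition f n k \o a.
  have /choice[N NP] j := iP n (a j).
  have [|||M MP] := @directed_family_ub _ (fun x y => x <= y) m N.
  - exact: (inhabits 0).
  - by move=> x y z; exact: leq_trans.
  - by move=> x y; exists (maxn x y); rewrite leq_maxl leq_maxr.
  exists M => k Mk; apply/funext => j /=.
  by have [_ ->] := NP j k (leq_trans (MP j) Mk).
exists i; split.
- move=> n; split.
  + move=> x y.
    have [N NP] := iP n x; have [M MP] := iP n y.
    have [_ <-] := NP _ (leq_maxl N M); have [_ <-] := MP _ (leq_maxr N M).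
    by have [inj _ _] := aE n (maxn N M); exact: inj.
  + move=> s a; have [N NP] := common _ n a; have [M MP] := iP n (finterp a).
    have [_ <-] := MP _ (leq_maxr N M); rewrite (NP _ (leq_maxl N M)).
    by have [_ hF _] := aE n (maxn N M); rewrite -hF.
  + move=> s a; have [N NP] := common _ n a; rewrite (NP _ (leqnn N)).
    by have [_ _ ->] := aE n N.
- move=> n x; have [N NP] := iP n x; have [M MP] := iP n.+1 (f n x).
  have [_ <-] := NP _ (leq_maxl N M); have [nk <-] := MP _ (leq_maxr N M).
  by rewrite transitionSl.
- move=> y; have [j <-] := uS y.
  have pre k : exists x, al k x = u j.
    by have [_ [h _ hK]] := alA k; exists (h (u j)).
  have [x xE] := pre j; exists j, x; have [N NP] := iP j x.
  have [_ <-] := NP _ (leq_maxr j N).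
  (* From stage [j] on, the preimage of [u j] is in the protected set, so each further step maps it
     to [u j] again. *)
  have H k : j <= k -> al k (transition f j k x) = u j.
    elim: k => [|k IH]; rewrite leq_eqVlt => /orP[/eqP<-|jk //];
      try by rewrite transition_geq.
    rewrite transitionS //= alS ?IH //; right; rewrite /preimage /= IH //.
    by exists j.
  exact: H (leq_maxl j N).
Qed.

(** * Extending countably many automorphisms *)

(* One back-and-forth step: the pair (a, b) stands for the partial isomorphism
   [a x |-> b x], and (a', b') extends its image under F to one whose domain
   and range contain [range F]. *)
Lemma amalgamation_step (L : language) (U : structure L) (M : set (U -> U))
    (a b : U -> U) :
  submonoid_Emb M -> amalgamation_property M -> M a -> M b ->
  exists F a' b', [/\ M F, M a' & M b'] /\
    [/\ forall x, exists y, a' y = F (a x) /\ b' y = F (b x),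
        forall z, exists y, a' y = F z & forall z, exists y, b' y = F z].
Proof.
move=> HM amM Ma Mb.
have [f1 [b1 [Mf1 Mb1 fb1]]] := amM _ _ Mb Ma.
have [a2 [f2 [Ma2 Mf2 af2]]] := amM _ _ Mb1 Mf1.
have {}fb1 x : f1 (b x) = b1 (a x) := congr1 (@^~ x) fb1.
have {}af2 x : a2 (b1 x) = f2 (f1 x) := congr1 (@^~ x) af2.
exists (f2 \o f1), a2, f2; split; first by split=> //; exact: submonoid_comp.
split=> [x|z|z] /=; last by exists (f1 z).
- by exists (b1 (a x)); rewrite af2 fb1.
- by exists (b1 z).
Qed.

(** The 2-adic valuation takes the value [k] at all odd multiples of [2 ^ k]. It serves to return to
    each of countably many tasks infinitely often. *)
Lemma unbounded_schedule :
  exists s : nat -> nat, forall k N, exists2 n, N <= n & s n = k.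
Proof.
exists (logn 2) => k N; exists (2 ^ k * N.*2.+1).
  apply: leq_trans (leq_pmull _ (expn_gt0 2 k)).
  by rewrite -addnn -addnS leq_addr.
rewrite lognM ?expn_gt0 // pfactorK // logn_coprime ?addn0 //.
by rewrite prime_coprime // dvdn2 /= odd_double.
Qed.

(** At time [n] the pair [st n k] codes a partial isomorphism extending the image of [g k]. Each
    step applies back-and-forth to the scheduled pair and moves all others along [F n]. In the
    colimit of the [F n], again a copy of [U], every pair has become an automorphism; only this
    passage to the limit may leave [M]. The map [e] misses a point because [f0] does. *)
Lemma common_extension (L : language) (U : structure L) (u : nat -> U)
    (M : set (U -> U)) (g : nat -> U -> U) :
  homogeneous U -> (forall x, exists n, u n = x) ->
  submonoid_Emb M -> @Aut L U `<=` M ->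
  (exists f, M f /\ range f <> [set: U]) -> amalgamation_property M ->
  (forall k, Aut (g k)) ->
  exists e : U -> U, [/\ is_embedding e, exists y, forall x, e x <> y &
    forall k, exists2 h : U -> U, Aut h & forall x, h (e x) = e (g k x)].
Proof.
move=> hU uS HM AutM [f0 [Mf0 f0N]] amM gA.
have [sched schedP] := unbounded_schedule.
have Membed f : M f -> is_embedding f := @submonoid_sub _ _ _ HM f.
have /choice[next nextP] (ab : (U -> U) * (U -> U)) :
    exists r : (U -> U) * ((U -> U) * (U -> U)), M ab.1 -> M ab.2 ->
    [/\ M r.1, M r.2.1 & M r.2.2] /\
    [/\ forall x, exists y, r.2.1 y = r.1 (ab.1 x) /\ r.2.2 y = r.1 (ab.2 x),
        forall z, exists y, r.2.1 y = r.1 z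
      & forall z, exists y, r.2.2 y = r.1 z].
  have [[Ma Mb]|N] := pselect (M ab.1 /\ M ab.2).
    have [F [a' [b' H]]] := amalgamation_step HM amM Ma Mb.
    by exists (F, (a', b')).
  by exists (id, (id, id)) => Ma Mb; case: N.
have [st st0 stS] : exists2 st : nat -> nat -> (U -> U) * (U -> U),
    forall k, st 0 k = (f0, f0 \o g k) & forall n k, st n.+1 k =
      let r := next (st n (sched n)) in
      if k == sched n then r.2 else (r.1 \o (st n k).1, r.1 \o (st n k).2).
  by exists (fix st n := if n is n'.+1 then fun k =>
    let r := next (st n' (sched n')) in
    if k == sched n' then r.2 else (r.1 \o (st n' k).1, r.1 \o (st n' k).2)
    else fun k => (f0, f0 \o g k)).
have stM n k : M (st n k).1 /\ M (st n k).2.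
  elim: n k => [|n IH] k.
    by rewrite st0; split=> //; apply: submonoid_comp => //; exact: AutM.
  have [Ms1 Ms2] := IH (sched n).
  have [[MF Ma Mb] _] := nextP _ Ms1 Ms2.
  rewrite stS /=; case: ifP => _ //.
  by have [Mk1 Mk2] := IH k; split; exact: submonoid_comp.
pose F n := (next (st n (sched n))).1.
have nextE n := nextP _ (stM n (sched n)).1 (stM n (sched n)).2.
have FE n : is_embedding (F n) by have [[MF _ _] _] := nextE n; exact: Membed.
have extend n k x : exists y, (st n.+1 k).1 y = F n ((st n k).1 x) /\
    (st n.+1 k).2 y = F n ((st n k).2 x).
  rewrite stS /=; case: ifP => [/eqP->|_]; last by exists x.
  by have [_ [H _ _]] := nextE n; exact: H.
have [i [iE iF iS]] := chain_colimit hU uS FE.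
have iEI n : injective (i n) by have [] := iE n.
have shift n m z : n <= m -> exists z', i m z' = i n z.
  elim: m => [|m IH]; rewrite leq_eqVlt => /orP[/eqP<-|//]; try by exists z.
  by rewrite ltnS => /IH[z' <-]; exists (F m z'); rewrite iF.
exists (i 0 \o f0); split.
- by apply: embedding_comp => //; exact: Membed.
- have [y yN] : exists y, forall x, f0 x <> y.
    apply: contrapT => H; apply: f0N; apply/seteqP; split=> // y _.
    apply: contrapT => yN; apply: H; exists y => x fx; apply: yN.
    by exists x.
  by exists (i 0 y) => x /iEI; exact: yN.
move=> k.
pose p n := i n \o (st n k).1; pose q n := i n \o (st n k).2.
have lift n m : n <= m -> forall x, exists y, p m y = p n x /\ q m y = q n x.
  elim: m => [|m IH]; rewrite leq_eqVlt => /orP[/eqP<-|//];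
    try by move=> x; exists x.
  rewrite ltnS => /IH{}IH x; have [y [<- <-]] := IH x.
  have [z [z1 z2]] := extend m k y.
  by exists z; rewrite /p /q /= z1 z2 !iF.
have [||||||h hA hE] := @glue_isomorphism L U U nat (fun=> U) p q.
- exact: (inhabits 0).
- by move=> n; apply: embedding_comp (iE n); apply: Membed; case: (stM n k).
- by move=> n; apply: embedding_comp (iE n); apply: Membed; case: (stM n k).
- by move=> n m; exists (maxn n m); split; apply: lift;
    rewrite ?leq_maxl ?leq_maxr.
(* The point [v] is visible at some time [n], hence at a later time [m] scheduled for [k]; that step
   puts it into the domain. *)
- move=> v; have [n [z <-]] := iS v; have [m nm mk] := schedP k n.
  have [z' <-] := shift _ _ z nm; rewrite -iF.
  have [_ [_ H _]] := nextE m; have [y yE] := H z'.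
  by exists m.+1, y; rewrite /p stS /= mk eqxx -[F m z']yE mk.
- move=> v; have [n [z <-]] := iS v; have [m nm mk] := schedP k n.
  have [z' <-] := shift _ _ z nm; rewrite -iF.
  have [_ [_ _ H]] := nextE m; have [y yE] := H z'.
  by exists m.+1, y; rewrite /q stS /= mk eqxx -[F m z']yE mk.
by exists h => // x; have := hE 0 x; rewrite /p /q st0.
Qed.

(** * A set of cardinality aleph_1 *)

Lemma well_order_relpre (V T : Type) (R : rel T) (f : V -> T) :
  injective f -> well_order R -> well_order (relpre f R).
Proof.
move=> fI RW A [a Aa].
pose B := [pred t | `[< exists2 v, v \in A & f v = t >]].
have BP t : reflect (exists2 v, v \in A & f v = t) (t \in B) by exact: asboolP.
have fB v : v \in A -> f v \in B by move=> Av; apply/BP; exists v.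
have [|t [[/BP[v Av <-] vmin] vU]] := RW B; first by exists (f a); exact: fB.
exists v; split; first by split=> // w /fB/vmin.
move=> w [Aw wmin]; apply/fI/vU; split; first exact: fB.
by move=> t' /BP[x Ax <-]; exact: wmin.
Qed.

Lemma countable_setU (T : Type) (A B : set T) :
  countable A -> countable B -> countable (A `|` B).
Proof.
move=> Ac Bc.
have -> : A `|` B = \bigcup_(b in [set: bool]) (if b then A else B).
  apply/seteqP; split=> [x [Ax|Bx]|x [[] _]].
  - by exists true.
  - by exists false.
  - by left.
  - by right.
by apply: bigcup_countable => [|[]].
Qed.

Lemma countable_inj (V T : Type) (f : V -> T) (A : set V) (B : set T) :
  injective f -> (forall x, A x -> B (f x)) -> countable B -> countable A.
Proof.
move=> fI fAB /countable_injP[g gI]; apply/countable_injP.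
exists (g \o f) => x y /set_mem Ax /set_mem Ay /= e; apply: fI.
by apply: gI e; apply: mem_set; exact: fAB.
Qed.

Lemma aleph1_inj (V T : Type) (f : V -> T) :
  injective f -> cardinality_aleph1 T -> ~ countable [set: V] ->
  cardinality_aleph1 V.
Proof.
move=> fI [R [RW _ Rseg]] Vunc; exists (relpre f R); split=> //.
  exact: well_order_relpre.
by move=> x; apply: countable_inj fI _ (Rseg (f x)).
Qed.

(** Cantor's diagonal: [D] differs at [n] from any sequence with code [n]. *)
Lemma uncountable_sequences : ~ countable [set: nat -> bool].
Proof.
move=> /countable_injP[f fI].
pose D n := `[< exists S : nat -> bool, f S = n /\ ~~ S n >].
have DN : ~ D (f D).
  move=> /[dup] DD /asboolP[S [e /negP SN]]; apply: SN.
  by rewrite (fI S D) ?in_setT // e.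
by apply: (DN); apply/asboolP; exists D; split=> //; apply/negP.
Qed.

(* The carrier is built from [nat -> bool] rather than [set nat] because
   [set nat] lives in a universe above that of the structures. *)
Lemma exists_aleph1 : exists T : Type, cardinality_aleph1 T.
Proof.
pose W := {classic (nat -> bool)}.
have Wunc : ~ countable [set: nat -> bool] := uncountable_sequences.
have [R RW] := well_ordering_principle W.
pose A := [pred x : W | ~~ `[< countable [set y | R y x] >]].
have AP x : reflect (~ countable [set y | R y x]) (x \in A) by exact: asboolPn.
(* If no segment is uncountable, the whole well-order will do; otherwise take the strict segment
   below the least [z] with an uncountable segment. *)
have [[z0 Az0]|AN] := pselect (nonempty A); last first.
  by exists (nat -> bool), R; split=> // x; apply: contrapT => /AP xA; apply: AN; exists x.
have [|z [[/AP zunc zmin] _]] := RW A; first by exists z0.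
have Ranti : antisymmetric R.
  move=> x y xy; apply: (wo_chain_antisymmetric (C := predT)) xy => //.
  by move=> B _; exact: RW.
exists {y : nat -> bool | R y z && ((y : W) != z)}, (relpre val R); split.
- exact: well_order_relpre val_inj RW.
- move=> segc; apply: zunc.
  have segU : [set y | R y z] `<=`
      val @` [set: {y : nat -> bool | R y z && ((y : W) != z)}] `|` [set z].
    move=> y /= Ryz; have [->|yz] := eqVneq (y : W) z; [by right|left].
    by have H : R y z && ((y : W) != z) by [rewrite Ryz]; exists (exist _ y H).
  apply: sub_countable (subset_card_le segU) _; apply: countable_setU.
    exact: sub_countable (card_image_le _ _) segc.
  exact/finite_set_countable/finite_set1.
- move=> [x /= /andP[Rxz xz]].
  apply: (@countable_inj _ _ val _ [set y | R y x] val_inj) => //.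
  apply: contrapT => /AP/zmin Rzx.
  by move/eqP: xz; apply; apply: Ranti; rewrite Rxz.
Qed.

(** Outside a countable set [T] still has infinitely many points, and [U] is countable. This is the
    room for the new points of a larger copy. *)
Lemma injection_avoiding (U T : Type) (u : nat -> U) (D : set T) :
  (forall x, exists n, u n = x) -> ~ countable [set: T] -> countable D ->
  exists2 f : U -> T, injective f & forall x, ~ D (f x).
Proof.
move=> uS; elim/Ppointed: T => T in D *.
  by case; rewrite emptyE; exact: countable0.
move=> Tunc Dc; have : infinite_set (~` D).
  by move=> /finite_set_countable/(countable_setU Dc); rewrite setUv.
move=> /infiniteP/pcard_leP[f]; have /choice[r ur] := uS.
exists (f \o r) => [x y /= e|x]; last exact: (@funS _ _ _ _ f (r x) I).
by rewrite -(ur x) -(ur y); congr u; apply: 'inj_f e; rewrite in_setT.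
Qed.

(** * Stages: copies of U inside T *)

(** Finite partial maps are lists of pairs over [T], not over [U], so that one list can be compared
    in different copies. *)
Definition sends (U : Type) (T : eqType) (phi : U -> T) (g : U -> U)
    (l : seq (T * T)) : Prop :=
  forall p, p \in l -> exists x, p = (phi x, phi (g x)).

(* A copy of U placed on a subset of T, together with a choice, for every
   finite partial isomorphism of the copy, of an automorphism extending it. *)
Record stage (L : language) (U : structure L) (T : eqType) := Stage {
  place : U -> T;
  witness : seq (T * T) -> U -> U;
  place_inj : injective place;
  witness_aut : forall l, Aut (witness l);
  witness_sends : forall l g, Aut g -> sends place g l ->
    sends place (witness l) l }.

Definition extendible (L : language) (U : structure L) (T : eqType)
    (X : stage U T) (l : seq (T * T)) : Prop :=
  exists2 g : U -> U, Aut g & sends (place X) g l.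

Definition extends_by (L : language) (U : structure L) (T : eqType)
    (X Y : stage U T) (e : U -> U) : Prop :=
  [/\ is_embedding e, forall x, place Y (e x) = place X x &
    forall l, extendible X l -> forall x, witness Y l (e x) = e (witness X l x)].

Definition extends (L : language) (U : structure L) (T : eqType)
    (X Y : stage U T) : Prop := exists e, extends_by X Y e.

Lemma witness_extendible (L : language) (U : structure L) (T : eqType)
    (X : stage U T) (l : seq (T * T)) :
  extendible X l -> sends (place X) (witness X l) l.
Proof. by move=> [g gA gl]; exact: witness_sends gl. Qed.

Lemma extends_by_sends (L : language) (U : structure L) (T : eqType)
    (phi psi : U -> T) (e g h : U -> U) (l : seq (T * T)) :
  (forall x, psi (e x) = phi x) -> (forall x, h (e x) = e (g x)) ->
  sends phi g l -> sends psi h l.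
Proof.
move=> psie he gl p /gl[x ->]; exists (e x).
by rewrite he !psie.
Qed.

Lemma extends_extendible (L : language) (U : structure L) (T : eqType)
    (X Y : stage U T) (l : seq (T * T)) :
  extends X Y -> extendible X l -> extendible Y l.
Proof.
move=> [e [eE pe we]] Xl; exists (witness Y l); first exact: witness_aut.
exact: extends_by_sends pe (we l Xl) (witness_extendible Xl).
Qed.

Lemma extends_refl (L : language) (U : structure L) (T : eqType)
    (X : stage U T) : extends X X.
Proof. by exists id; split=> //; exact: embedding_id. Qed.

Lemma extends_trans (L : language) (U : structure L) (T : eqType)
    (X Y Z : stage U T) : extends X Y -> extends Y Z -> extends X Z.
Proof.
move=> XY; have ext l := extends_extendible (l := l) XY.
move: XY => [e [eE pe we]] [f [fE pf wf]].
exists (f \o e); split=> [|x|l Xl x] /=.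
- exact: embedding_comp.
- by rewrite pf.
- by rewrite wf ?we //; exact: ext.
Qed.

(** It suffices to find, list by list, an automorphism coherent with the earlier choices. A list
    that no [X i] extends receives any automorphism that realizes it, or the identity if there is
    none. *)
Lemma stage_upper_bound (L : language) (U : structure L) (T : eqType)
    (I : Type) (X : I -> stage U T) (phi : U -> T) (e : I -> U -> U) :
  injective phi -> (forall i, is_embedding (e i)) ->
  (forall i x, phi (e i x) = place (X i) x) ->
  (forall l, (exists i, extendible (X i) l) ->
    exists2 g : U -> U, Aut g & forall i, extendible (X i) l ->
      forall x, g (e i x) = e i (witness (X i) l x)) ->
  exists2 Z : stage U T, place Z = phi & forall i, extends_by (X i) Z (e i).
Proof.
move=> phiI eE phie gE.
have /choice[w wP] l : exists w : U -> U, [/\ Aut w,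
    forall g, Aut g -> sends phi g l -> sends phi w l &
    forall i, extendible (X i) l ->
      forall x, w (e i x) = e i (witness (X i) l x)].
  have [|iN] := pselect (exists i, extendible (X i) l).
    move=> /[dup] /gE[g gA gw] [i il]; exists g; split=> // _ _ _.
    exact: extends_by_sends (phie i) (gw i il) (witness_extendible il).
  have [[g [gA gl]]|gN] := pselect (exists g, Aut g /\ sends phi g l).
    by exists g; split=> // i il; case: iN; exists i.
  exists id; split; first exact: isomorphism_id.
    by move=> g gA gl; case: gN; exists g.
  by move=> i il; case: iN; exists i.
have wA l : Aut (w l) by case: (wP l).
have ws l : forall g, Aut g -> sends phi g l -> sends phi (w l) l.
  by case: (wP l).
exists (Stage phiI wA ws) => // i; split=> // l il x.
by case: (wP l) => _ _; apply.
Qed.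

(** The upper bound of the empty family of stages. *)
Lemma stage_exists (L : language) (U : structure L) (T : eqType)
    (phi : U -> T) : injective phi -> exists X : stage U T, place X = phi.
Proof.
move=> phiI.
have [] := @stage_upper_bound _ U T void (of_void _) phi (of_void _) phiI.
- by case.
- by case.
- by move=> l [[]].
by move=> X XE _; exists X.
Qed.

Lemma countable_range_enum (U T : Type) (u : nat -> U) (f : U -> T) :
  (forall x, exists n, u n = x) -> countable (range f).
Proof.
move=> uS; have -> : range f = (f \o u) @` [set: nat].
  apply/seteqP; split=> [_ [x _ <-]|_ [n _ <-]]; last by exists (u n).
  by have [n <-] := uS x; exists n.
exact: sub_countable (card_image_le _ _) (countableP _).
Qed.

(** Used to index by codes in [nat] all lists that a copy can send. *)
Lemma sends_enum (U : Type) (T : eqType) (u : nat -> U) (phi : U -> T)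
    (g : U -> U) (l : seq (T * T)) :
  (forall x, exists n, u n = x) -> sends phi g l ->
  exists m : seq (nat * nat), l = [seq (phi (u p.1), phi (u p.2)) | p <- m].
Proof.
move=> uS; elim: l => [|p l IH] gl; first by exists [::].
have [m ->] := IH (fun q ql => gl q (mem_behead (s := p :: l) ql)).
have [x ->] := gl p (mem_head _ _).
have [a xE] := uS x; have [b gxE] := uS (g x).
by exists ((a, b) :: m); rewrite /= xE gxE.
Qed.

Lemma proper_extension (L : language) (U : structure L) (T : eqType)
    (u : nat -> U) (M : set (U -> U)) (X : stage U T) :
  homogeneous U -> (forall x, exists n, u n = x) ->
  submonoid_Emb M -> @Aut L U `<=` M ->
  (exists f, M f /\ range f <> [set: U]) -> amalgamation_property M ->
  ~ countable [set: T] ->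
  exists2 Y : stage U T, extends X Y &
    exists y, forall x, place X x <> place Y y.
Proof.
move=> hU uS HM AutM nsM amM Tunc.
pose code n : seq (T * T) :=
  [seq (place X (u p.1), place X (u p.2)) |
     p <- odflt [::] (unpickle n : option (seq (nat * nat)))].
have [e [eE [y0 y0N] hE]] := common_extension hU uS HM AutM nsM amM
  (fun n => witness_aut X (code n)).
have eI : injective e by case: eE.
have [iota iotaI iotaN] := injection_avoiding uS Tunc
  (countable_range_enum (place X) uS).
have /choice[phi phiP] y : exists t, (exists2 x, e x = y & t = place X x) \/
    ((forall x, e x <> y) /\ t = iota y).
  have [[x xy]|N] := pselect (exists x, e x = y).
    by exists (place X x); left; exists x.
  by exists (iota y); right; split=> // x xy; apply: N; exists x.
have phie x : phi (e x) = place X x.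
  by case: (phiP (e x)) => [[x' /eI -> //]|[/(_ x)]].
have phiI : injective phi.
  move=> y z; case: (phiP y) => [[x <- ->]|[_ ->]];
    case: (phiP z) => [[x' <- ->]|[_ ->]].
  - by move=> /place_inj ->.
  - by move=> xz; case: (iotaN z); exists x.
  - by move=> yx; case: (iotaN y); exists x'.
  - exact: iotaI.
have [|||Y YE XY] := @stage_upper_bound _ U T unit (fun=> X) phi (fun=> e) phiI.
- by [].
- by move=> _; exact: phie.
- move=> l [_ [g gA gl]]; have [m lE] := sends_enum uS gl.
  have [h hA he] := hE (pickle m); exists h => // _ _ x.
  by rewrite he /code pickleK /= -lE.
exists Y; first by exists e; exact: XY tt.
exists y0 => x; rewrite YE -phie => /phiI; exact: y0N.
Qed.

(** The places pass to the colimit of the copies, and so do, for each list, the witnesses from its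
    first extendible stage on. *)
Lemma stage_sequence_upper_bound (L : language) (U : structure L) (T : eqType)
    (u : nat -> U) (X : nat -> stage U T) :
  homogeneous U -> (forall x, exists n, u n = x) ->
  (forall n, extends (X n) (X n.+1)) ->
  exists Z : stage U T, forall n, extends (X n) Z.
Proof.
move=> hU uS XS; have /choice[e eP] := XS.
have eE n : is_embedding (e n) by case: (eP n).
have pe n x : place (X n.+1) (e n x) = place (X n) x by case: (eP n).
have we n l x : extendible (X n) l ->
    witness (X n.+1) l (e n x) = e n (witness (X n) l x).
  by case: (eP n) => _ _ we il; exact: we.
have ext n m l : n <= m -> extendible (X n) l -> extendible (X m) l.
  elim: m => [|m IH]; rewrite leq_eqVlt => /orP[/eqP<-//|//].
  by rewrite ltnS => nm /(IH nm); exact: extends_extendible (XS m).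
have [i [iE ie iS]] := chain_colimit hU uS eE.
have lift n m : n <= m -> forall x, exists y,
    [/\ i m y = i n x, place (X m) y = place (X n) x &
      forall l, extendible (X n) l ->
        i m (witness (X m) l y) = i n (witness (X n) l x)].
  elim: m => [|m IH]; rewrite leq_eqVlt => /orP[/eqP<-|//];
    try by move=> x; exists x.
  rewrite ltnS => nm x; have [y [<- <- yw]] := IH nm x.
  exists (e m y); split=> // l nl; rewrite we ?ie ?yw //.
  exact: ext nl.
have /choice[phi phiP] v : exists t, exists n x, i n x = v /\ place (X n) x = t.
  by have [n [x <-]] := iS v; exists (place (X n) x), n, x.
have phii n x : phi (i n x) = place (X n) x.
  have [m [y [yx <-]]] := phiP (i n x).
  have [x' [x'E <- _]] := lift _ _ (leq_maxl n m) x.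
  have [y' [y'E <- _]] := lift _ _ (leq_maxr n m) y.
  have [iI _ _] := iE (maxn n m).
  by congr place; apply: iI; rewrite y'E x'E.
have phiI : injective phi.
  move=> v w; have [n [x <-]] := iS v; have [m [y <-]] := iS w.
  have [x' [<- _ _]] := lift _ _ (leq_maxl n m) x.
  have [y' [<- _ _]] := lift _ _ (leq_maxr n m) y.
  by rewrite !phii => /place_inj ->.
have [//|//||Z _ XZ] := @stage_upper_bound _ U T nat X phi i phiI; last first.
  by exists Z => n; exists (i n); exact: XZ.
move=> l [n0 n0l].
have exn : exists n, `[< extendible (X n) l >] by exists n0; apply/asboolP.
case: (ex_minnP exn) => n /asboolP nl nmin.
have wE k : is_embedding (witness (X k) l) by case: (witness_aut (X k) l).
have nS v : exists k x, n <= k /\ i k x = v.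
  have [k [x <-]] := iS v; have [y [<- _ _]] := lift _ _ (leq_maxr n k) x.
  by exists (maxn n k), y; rewrite leq_maxl.
(* The witnesses for [l] are known to cohere only from [n] on, hence the shift; by minimality of [n]
   no stage that extends [l] is lost. *)
have [||||||g gA gE] := @glue_isomorphism _ U U nat (fun=> U)
  (fun k => i (n + k)) (fun k => i (n + k) \o witness (X (n + k)) l).
- exact: (inhabits 0).
- by [].
- by move=> k; exact: embedding_comp.
- have le_lift a c : a <= c -> forall x, exists y, i (n + c) y = i (n + a) x /\
      (i (n + c) \o witness (X (n + c)) l) y =
      (i (n + a) \o witness (X (n + a)) l) x.
    rewrite -(leq_add2l n) => ac x; have [y [yx _ yw]] := lift _ _ ac x.
    by exists y; split=> //; apply: yw; apply: ext nl; exact: leq_addr.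
  by move=> a b; exists (maxn a b); split; apply: le_lift;
    rewrite ?leq_maxl ?leq_maxr.
- move=> v; have [k [x [nk <-]]] := nS v.
  by exists (k - n), x; rewrite subnKC.
- move=> v; have [k [x [nk <-]]] := nS v.
  have [_ [w' _ wK]] := witness_aut (X k) l.
  by exists (k - n), (w' x); rewrite subnKC //= wK.
exists g => // m ml x; have nm : n <= m by apply: nmin; apply/asboolP.
by have := gE (m - n) x; rewrite subnKC.
Qed.

(** * Directed unions of copies *)

(** A symbol is evaluated in any copy that contains its arguments; passing to a common larger copy
    shows that the choice does not matter. *)
Lemma directed_union (L : language) (U : structure L) (T I : Type)
    (phi : I -> U -> T) :
  inhabited I -> (forall i, injective (phi i)) ->
  (forall i j, exists k,
    (exists2 e, is_embedding e & forall x, phi k (e x) = phi i x) /\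
    (exists2 e, is_embedding e & forall x, phi k (e x) = phi j x)) ->
  exists (V : structure L) (v : V -> T) (iota : I -> U -> V),
    [/\ injective v, forall i, is_embedding (iota i),
      forall i x, v (iota i x) = phi i x &
      forall y, exists i x, iota i x = y].
Proof.
move=> I0 phiI dir; pose carr := {t : T | exists i x, phi i x = t}.
pose io i x : carr := exist _ (phi i x) (ex_intro _ i (ex_intro _ x erefl)).
have vI : injective (fun y : carr => sval y).
  by move=> [x xP] [y yP] /= e; exact: eq_exist.
have ioI i : injective (io i) by move=> x y /(congr1 sval)/phiI.
have ioS y : exists i x, io i x = y.
  by case: (y) => t [i [x e]]; exists i, x; apply: vI.
pose le i j := exists2 e : U -> U, is_embedding e & forall x, io j (e x) = io i x.
have letr i j k : le i j -> le j k -> le i k.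
  move=> [e eE ie] [f fE jf]; exists (f \o e); first exact: embedding_comp.
  by move=> x /=; rewrite jf ie.
have ledir i j : exists k, le i k /\ le j k.
  have [k [[e eE ie] [f fE jf]]] := dir i j.
  exists k; split; first by exists e => // x; apply: vI; exact: ie.
  by exists f => // x; apply: vI; exact: jf.
have common n (a : 'I_n -> carr) : exists i (c : 'I_n -> U), a = io i \o c.
  have /choice[f fP] j := ioS (a j).
  have [k kP] := directed_family_ub f I0 letr ledir.
  have /choice[c cP] j : exists x, io k x = a j.
    by have [x <-] := fP j; have [e _ <-] := kP j; exists (e x).
  by exists k, c; apply/funext => j /=.
have func_ex s (a : 'I_(farity s) -> carr) : exists y, exists i (c : _ -> U),
    a = io i \o c /\ y = io i (finterp c).
  by have [i [c ->]] := common _ a; exists (io i (finterp c)), i, c.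
pose V := @Structure L carr (fun s a => projT1 (cid (func_ex s a)))
  (fun s a => exists i (c : _ -> U), a = io i \o c /\ rinterp c).
exists V, (fun y : carr => sval y), io; split=> // i; split=> //.
  move=> s a; rewrite -[RHS]/(projT1 (cid (func_ex s (io i \o a)))).
  have [j [c [ac ->]]] := projT2 (cid (func_ex s (io i \o a))).
  have [k [[e eE ie] [f fE jf]]] := ledir i j.
  have eac : e \o a = f \o c.
    apply/funext => r; apply: (ioI k); rewrite /= ie jf.
    exact: (congr1 (fun h => h r) ac).
  rewrite -ie -jf; have [_ -> _] := eE; have [_ -> _] := fE.
  by rewrite eac.
move=> s a /=; split=> [ra|[j [c [ac rc]]]]; first by exists i, a.
have [k [[e eE ie] [f fE jf]]] := ledir i j.
have eac : e \o a = f \o c.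
  apply/funext => r; apply: (ioI k); rewrite /= ie jf.
  exact: (congr1 (fun h => h r) ac).
have [_ _ eR] := eE; have [_ _ fR] := fE.
by rewrite eR eac -fR.
Qed.

(** A finite generating set of [S] and its image under [f] give a finite list [l], which lies in one
    copy [k] and is extendible there by homogeneity of [U]. The witnesses for [l] in the copies
    above [k] are coherent and glue to an automorphism of [V]. *)
Lemma stage_union_homogeneous (L : language) (U : structure L) (T : eqType)
    (I : Type) (X : I -> stage U T) (V : structure L) (v : V -> T)
    (iota : I -> U -> V) :
  homogeneous U -> inhabited I ->
  (forall i j, exists k, extends (X i) (X k) /\ extends (X j) (X k)) ->
  injective v -> (forall i, is_embedding (iota i)) ->
  (forall i x, v (iota i x) = place (X i) x) ->
  (forall y, exists i x, iota i x = y) ->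
  homogeneous V.
Proof.
move=> hU [i0] dir vI iotaE viota iotaS S S' Sfg _ f fI.
have lift i j : extends (X i) (X j) -> forall x, exists y,
    iota j y = iota i x /\ forall l, extendible (X i) l ->
      iota j (witness (X j) l y) = iota i (witness (X i) l x).
  move=> [e [_ pe we]] x.
  have je z : iota j (e z) = iota i z by apply: vI; rewrite !viota.
  by exists (e x); split=> // l il; rewrite we.
have cover (l : seq (T * T)) :
    (forall p, p \in l -> exists y1 y2, p = (v y1, v y2)) ->
    exists k, forall p, p \in l ->
      exists x1 x2, p = (place (X k) x1, place (X k) x2).
  elim: l => [|p l IH] lP; first by exists i0.
  have [k kP] := IH (fun q ql => lP q (mem_behead (s := p :: l) ql)).
  have [y1 [y2 pE]] := lP p (mem_head _ _).
  have [i [x1 ix1]] := iotaS y1; have [j [x2 jx2]] := iotaS y2.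
  have [m [im jm]] := dir i j; have [n [mn kn]] := dir m k.
  exists n => q; rewrite in_cons => /orP[/eqP->|/kP[z1 [z2 ->]]].
    have [t1 [n1 _]] := lift _ _ (extends_trans im mn) x1.
    have [t2 [n2 _]] := lift _ _ (extends_trans jm mn) x2.
    by exists t1, t2; rewrite pE -!viota n1 n2 ix1 jx2.
  have [t1 [n1 _]] := lift _ _ kn z1; have [t2 [n2 _]] := lift _ _ kn z2.
  by exists t1, t2; rewrite -!viota n1 n2 !viota.
have vE : is_embedding (fun c : induced S => sval c) by exact: induced_val_embedding.
have vfE : is_embedding (fun c : induced S => sval (f c)).
  by apply: (@embedding_comp _ _ _ _ f); [case: fI|exact: induced_val_embedding].
have [G [Gfin /generatesP Ggen]] := Sfg.
pose pair (c : induced S) := (v (sval c), v (sval (f c))).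
have /finite_seqP[l lE] : finite_set (pair @` G) by exact: finite_image.
have Gl c : G c -> pair c \in l.
  by move=> Gc; have : (pair @` G) (pair c) by [exists c]; rewrite lE.
have [k kP] : exists k, forall c, G c ->
    range (iota k) (sval c) /\ range (iota k) (sval (f c)).
  have [p|k kP] := cover l.
    move=> pl; have : (pair @` G) p by rewrite lE.
    by case=> c _ <-; exists (sval c), (sval (f c)).
  exists k => c /Gl/kP[x1 [x2 [e1 e2]]].
  by split; [exists x1 | exists x2] => //; apply: vI; rewrite viota.
have /choice[p pE] (c : induced S) : exists x, iota k x = sval c.
  have H := Ggen _ (fclosed_preimage vE (fclosed_range (iotaE k))).
  by have [|x _ <-] := H _ c; [move=> d /kP[]|exists x].
have /choice[q qE] (c : induced S) : exists x, iota k x = sval (f c).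
  have H := Ggen _ (fclosed_preimage vfE (fclosed_range (iotaE k))).
  by have [|x _ <-] := H _ c; [move=> d /kP[]|exists x].
have pemb : is_embedding p.
  apply: (embedding_factor (iotaE k)).
  by have -> : iota k \o p = (fun c => sval c) by exact/funext.
have qemb : is_embedding q.
  apply: (embedding_factor (iotaE k)).
  by have -> : iota k \o q = (fun c => sval (f c)) by exact/funext.
have kl : extendible (X k) l.
  have [g gA gE] := homogeneous_emb hU Sfg pemb qemb.
  exists g => // r rl; have : (pair @` G) r by rewrite lE.
  by case=> c _ <-; exists (p c); rewrite gE -!viota pE qE.
have wemb i : is_embedding (witness (X i) l) by case: (witness_aut (X i) l).
(* The two maps agree on the generators [G], where [l] prescribes the values, and their equalizer is
   closed. *)
have wpq c : witness (X k) l (p c) = q c.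
  apply: (Ggen _ (fclosed_equalizer (embedding_comp pemb (wemb k)) qemb)) => d Gd.
  have [x [dx dw]] := witness_extendible kl (Gl d Gd).
  have xd : x = p d by apply: (place_inj (s := X k)); rewrite -dx -viota pE.
  by apply: (place_inj (s := X k)); rewrite /= -xd -dw -viota qE.
(* The stages above [k], where [l] is extendible, are cofinal by directedness. *)
pose J := {i : I | extends (X k) (X i)}.
have Jdir i : exists j : J, extends (X i) (X (sval j)).
  have [j [ij kj]] := dir i k.
  by exists (exist (fun i => extends (X k) (X i)) j kj).
have [||||||g gA gE] := @glue_isomorphism _ V V J (fun=> U)
  (fun j => iota (sval j)) (fun j => iota (sval j) \o witness (X (sval j)) l).
- by constructor; exists k; exact: extends_refl.
- by [].
- by move=> j; exact: embedding_comp.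
- have liftJ (i j : J) : extends (X (sval i)) (X (sval j)) ->
      forall x, exists y, iota (sval j) y = iota (sval i) x /\
      (iota (sval j) \o witness (X (sval j)) l) y =
      (iota (sval i) \o witness (X (sval i)) l) x.
    move=> ij x; have [y [yx yw]] := lift _ _ ij x; exists y; split=> //=.
    by apply/yw/(extends_extendible (proj2_sig i)).
  move=> i j; have [m [im jm]] := dir (sval i) (sval j).
  have [n mn] := Jdir m; exists n; split; apply: liftJ.
    exact: extends_trans im mn.
  exact: extends_trans jm mn.
- move=> y; have [i [x <-]] := iotaS y; have [j ij] := Jdir i.
  by have [z [<- _]] := lift _ _ ij x; exists j, z.
- move=> y; have [i [x <-]] := iotaS y; have [j ij] := Jdir i.
  have [z [<- _]] := lift _ _ ij x.
  have [_ [w' _ wK]] := witness_aut (X (sval j)) l.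
  by exists j, (w' z); rewrite /= wK.
exists g => // c; rewrite -pE -qE -wpq.
exact: (gE (exist _ k (extends_refl (X k))) (p c)).
Qed.

(** * Unbounded chains of stages *)

(** A strict step must occupy a new point of [T], so that it can be detected from the places
    alone. *)
Definition stage_le (L : language) (U : structure L) (T : eqType)
    (X Y : stage U T) : Prop :=
  X = Y \/ extends X Y /\ exists y, forall x, place X x <> place Y y.

Lemma stage_le_extends (L : language) (U : structure L) (T : eqType)
    (X Y : stage U T) : stage_le X Y -> extends X Y.
Proof. by case=> [->|[]//]; exact: extends_refl. Qed.

(** Take a chain that is maximal under inclusion. A proper extension [Y] of an upper bound could be
    added to it, being no member yet because it has a place outside every member. *)
Lemma exists_unbounded_chain (L : language) (U : structure L) (T : eqType) :
  (forall X : stage U T, exists2 Y, extends X Y &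
    exists y, forall x, place X x <> place Y y) ->
  exists2 A : set (stage U T), total_on A (@stage_le L U T) &
    ~ exists Z, forall X, A X -> extends X Z.
Proof.
move=> ext; have [|A [At Amax]] := @Zorn_bigcup (stage U T)
    (fun A => total_on A (@stage_le L U T)).
  move=> F FP Ft X Y [A FA AX] [B FB BY].
  have [AB|BA] := Ft _ _ FA FB; first by apply: (FP B) => //; exact: AB.
  by apply: (FP A) => //; exact: BA.
exists A => // -[Z ZP]; have [Y ZY [y yN]] := ext Z.
have AY X : A X -> extends X Y /\ exists y, forall x, place X x <> place Y y.
  move=> /ZP XZ; split; first exact: extends_trans ZY.
  by exists y => x; have [e [_ <- _]] := XZ.
apply: (Amax (A `|` [set Y])).
  split=> [X AX|/(_ Y (or_intror erefl))/AY[_ [z /(_ z)]//]].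
  by left.
move=> X X' [AX|->] [AX'|->]; first exact: At.
- by left; right; exact: AY.
- by right; right; exact: AY.
- by left; left.
Qed.

(** If the places were countable in number, members [B n] covering them would lie below an
    increasing sequence [Y n] in the chain. Either the [Y n] are cofinal and an upper bound of the
    sequence bounds [A], or some [X] in [A] lies above all [Y n]; such an [X] already has all the
    places, so no member is strictly above it and it bounds [A]. *)
Lemma unbounded_chain_uncountable (L : language) (U : structure L)
    (T : eqType) (u : nat -> U) (A : set (stage U T)) :
  homogeneous U -> (forall x, exists n, u n = x) -> A !=set0 ->
  total_on A (@stage_le L U T) ->
  (~ exists Z, forall X, A X -> extends X Z) ->
  ~ countable [set t | exists2 X, A X & exists x, place X x = t].
Proof.
move=> hU uS [X0 AX0] At Aunb /countable_enum[w wP]; apply: Aunb.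
have /choice[B BP] n : exists X, A X /\
    forall t, w n = Some t -> (exists2 Y, A Y & exists y, place Y y = t) ->
      exists x, place X x = t.
  case: (w n) => [t|]; last by exists X0.
  have [[X AX Xt]|N] := pselect (exists2 Y, A Y & exists y, place Y y = t).
    by exists X; split=> // _ [<-].
  by exists X0; split=> // _ [<-].
have /choice[join joinP] (XY : stage U T * stage U T) : exists Z,
    A XY.1 -> A XY.2 -> [/\ A Z, extends XY.1 Z & extends XY.2 Z].
  case: XY => X Y /=.
  have [[AX AY]|N] := pselect (A X /\ A Y); last by exists X => AX AY; case: N.
  by case: (At _ _ AX AY) => /stage_le_extends XY; [exists Y | exists X];
    split=> //; exact: extends_refl.
pose Y := fix Y n := if n is n'.+1 then join (Y n', B n) else B 0.
have AY n : A (Y n).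
  elim: n => [|n IH]; first exact: (BP 0).1.
  by case: (joinP (Y n, B n.+1) IH (BP n.+1).1).
have YS n : extends (Y n) (Y n.+1).
  by case: (joinP (Y n, B n.+1) (AY n) (BP n.+1).1).
have BY n : extends (B n) (Y n).
  case: n => [|n]; first exact: extends_refl.
  by case: (joinP (Y n, B n.+1) (AY n) (BP n.+1).1).
have [Z ZP] := stage_sequence_upper_bound hU uS YS.
have [H|] := pselect (forall X, A X -> exists n, extends X (Y n)).
  by exists Z => X /H[n Xn]; exact: extends_trans Xn (ZP n).
move=> /existsNP[X /not_implyP[AX /forallNP XN]]; exists X => X' AX'.
case: (At _ _ AX' AX) => [/stage_le_extends//|[<-|[_ [y yN]]]].
  exact: extends_refl.
have YX n : extends (Y n) X.
  by case: (At _ _ (AY n) AX) => /stage_le_extends // /XN.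
have tP : exists2 X', A X' & exists x, place X' x = place X' y.
  by exists X' => //; exists y.
exfalso.
have [n wn] : exists n, w n = Some (place X' y) by apply: wP; exists X' => //; exists y.
have [x Bx] : exists x, place (B n) x = place X' y.
  by apply: (BP n).2 => //; exists X' => //; exists y.
have [e [_ pe _]] := extends_trans (BY n) (YX n).
by apply: (yN (e x)); rewrite pe.
Qed.

Unset Implicit Arguments.

Theorem theorem4p7 (L : language) (HL : countable_language L)
    (K : set (structure L)) (HK : fraisse_class K)
    (U : structure L) (HU : fraisse_limit K U)
    (M : set (U -> U)) (HM : submonoid_Emb M)
    (HAut : @Aut L U `<=` M)
    (Hns : exists f, M f /\ range f <> [set: U])
    (Hamalg : amalgamation_property M) :
  exists V : structure L,
    [/\ homogeneous V, cardinality_aleph1 V & union_of_chain_of_copies V U].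
Proof.
have [Ucg hU _] := HU.
(* Every self-map of an empty structure is surjective, so [U] has a point, the default value for
   enumerating terms. *)
have [u0 _] : exists u0 : U, True.
  have [f [_ fN]] := Hns; apply: contrapT => UN; apply: fN.
  by apply/seteqP; split=> // x; case: UN; exists x.
have [u uS] := countably_generated_enum u0 HL Ucg.
have [T0 Taleph] := exists_aleph1; pose T : eqType := {classic T0}.
have Tunc : ~ countable [set: T0] by case: Taleph => R [].
have [A At Aunb] := exists_unbounded_chain (fun X : stage U T =>
  proper_extension X hU uS HM HAut Hns Hamalg Tunc).
(* An empty chain would be bounded by any stage. *)
have A0 : A !=set0.
  apply: contrapT => AN; apply: Aunb.
  have [phi phiI _] := injection_avoiding uS Tunc (countable0 T).
  have [X _] := stage_exists (T := T) phiI.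
  by exists X => Y AY; case: AN; exists Y.
pose I := {X : stage U T | A X}; pose X (i : I) := sval i.
have Xle (i j : I) : stage_le (X i) (X j) \/ stage_le (X j) (X i).
  exact: At (proj2_sig i) (proj2_sig j).
have dir (i j : I) : exists k, extends (X i) (X k) /\ extends (X j) (X k).
  by case: (Xle i j) => /stage_le_extends ij; [exists j | exists i];
    split=> //; exact: extends_refl.
have I0 : inhabited I by case: A0 => X0 AX0; constructor; exists X0.
have [||V [v [iota [vI iotaE viota iotaS]]]] :=
  directed_union (T := T0) (phi := fun i => place (X i)) I0.
- by move=> i; exact: (@place_inj _ _ T (X i)).
- move=> i j; have [k [[e [eE pe _]] [f [fE pf _]]]] := dir i j.
  by exists k; split; [exists e | exists f].
exists V; split.
- exact: stage_union_homogeneous hU I0 dir vI iotaE viota iotaS.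
(* The map [v] injects [V] into [T], and its image contains every place of the chain. *)
- apply: aleph1_inj vI Taleph _ => Vc.
  apply: (unbounded_chain_uncountable hU uS A0 At Aunb).
  apply: sub_countable Vc.
  apply: card_le_trans (card_image_le v setT); apply: subset_card_le.
  move=> t [Y AY [y <-]].
  by exists (iota (exist _ Y AY) y) => //; exact: viota.
exists [set S | exists i, S = range_substructure (iotaE i)]; split.
- have range_le i j : stage_le (X i) (X j) ->
      universe (range_substructure (iotaE i)) `<=`
      universe (range_substructure (iotaE j)).
    move=> /stage_le_extends[e [_ pe _]] _ [x _ <-]; exists (e x) => //.
    by apply: vI; rewrite !viota.
  move=> _ _ [i ->] [j ->].
  by case: (Xle i j) => /range_le; [left | right].
- move=> _ [i ->].
  have [g [gI _ _]] := isomorphism_inverse (corestriction_iso (iotaE i)).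
  by exists g.
- apply/seteqP; split=> // y _; have [i [x <-]] := iotaS y.
  by exists (range_substructure (iotaE i)); [exists i | exists x].
Qed.
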